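(* In the case $\alpha=1$, for any $-1<\theta<1$ and any $-1<x<1$, the series $$\frac{1}{\pi}\sum_{n=0}^{\infty}\sin\left(\tfrac{\pi}{2}(n+1)(1-\theta)\right)x^n$$ converges to the density $$g(x,1,\theta)=\frac{\cos(\pi\theta/2)}{\pi\left(x^2-2x\sin(\pi\theta/2)+1\right)}.$$
   Context: The function $g(x,1,\theta)$ displayed in the claim is the density of the standard strictly stable law with $\alpha=1$ (the asymmetric Cauchy distribution), i.e. the law with characteristic function $\exp\{-|t|\exp\{-i\tfrac{\pi}{2}\theta\,\mathrm{sign}\,t\}\}$, $t\in\mathbf{R}$. *)

(* Defs.v *)
From HB Require Import structures.
From mathcomp Require Import all_boot all_order all_algebra.
From mathcomp Require Import complex.
From mathcomp Require Import all_classical all_reals all_analysis.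

Set Implicit Arguments.
Unset Strict Implicit.
Unset Printing Implicit Defensive.

Import Order.TTheory GRing.Theory Num.Theory.
Import numFieldNormedType.Exports.

Local Open Scope classical_set_scope.
Local Open Scope ring_scope.

(* The complex exponential: e^(a + ib) = e^a (cos b + i sin b). *)
Definition cexp (R : realType) (z : R[i]) : R[i] :=
  (expR (complex.Re z))%:C%C *
  Complex (cos (complex.Im z)) (sin (complex.Im z)).

(* t |-> E[e^(itX)] for X of law P. The real-valued integrals are taken
   separately for the real part cos (t x) and the imaginary part sin (t x) of
   e^(itx); both integrands are bounded, hence P-integrable. *)
Definition charfun (R : realType) (P : probability (measurableTypeR R) R)
    (t : R) : R[i] :=
  Complex (\int[P]_x cos (t * x)) (\int[P]_x sin (t * x)).

Definition is_density (R : realType) (P : probability (measurableTypeR R) R)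
    (f : R -> R) : Prop :=
  [/\ measurable_fun setT f,
      forall x, 0 <= f x &
      forall A : set R, measurable A ->
        P A = (\int[@lebesgue_measure R]_(x in A) (f x)%:E)%E].

(* Standard strictly stable law, alpha = 1: exp {- |t| exp {- i (pi / 2) theta sign t}} *)
Definition stable1_charfun (R : realType) (theta t : R) : R[i] :=
  cexp (- (`|t|%:C%C
           * cexp (- ('i%C * (pi / 2 * theta * Num.sg t)%:C%C)))).

Definition stable1_pdf (R : realType) (theta x : R) : R :=
  cos (pi * theta / 2) / (pi * (x ^+ 2 - 2 * x * sin (pi * theta / 2) + 1)).

(* Main.v *)
Require Import Defs.
From HB Require Import structures.
From mathcomp Require Import all_boot all_order all_algebra.
From mathcomp Require Import complex.
From mathcomp Require Import all_classical all_reals all_analysis.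
From mathcomp Require Import measurable_realfun.
From mathcomp Require Import ring lra.

Set Implicit Arguments.
Unset Strict Implicit.
Unset Printing Implicit Defensive.

Import Order.TTheory GRing.Theory Num.Theory.
Import numFieldNormedType.Exports.

Local Open Scope classical_set_scope.
Local Open Scope ring_scope.

(** The stable density is the Cauchy density centred at s = sin (pi theta / 2)
    with scale c = cos (pi theta / 2), because x^2 - 2 x s + 1 = (x - s)^2 + c^2;
    an affine substitution thus reduces the characteristic function to
    F(t) = int cos(t x) / (1 + x^2) dx = pi e^(-|t|). For the latter, set
    G(t) = int (1 - cos(t x)) / (x^2 (1 + x^2)) dx, which may be differentiated
    twice under the integral sign, with G'' = F. By partial fractions
    F(t) = G(t) - int (1 - cos(t x)) / x^2 dx + pi, and the subtracted integral
    is linear in t > 0 by scaling, so F'' = F on t > 0; F being bounded and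
    continuous at 0 with F(0) = pi, it is pi e^(-t).
    The series is the imaginary part of a geometric series: its partial sums,
    multiplied by x^2 - 2 x cos psi + 1 where psi = pi (1 - theta) / 2, telescope. *)

(** * Affine change of variables for the Lebesgue integral *)

Lemma integral_mscale d (T : measurableType d) (R : realType)
    (m : {measure set T -> \bar R}) (k : {nonneg R}) (f : T -> \bar R) :
  m.-integrable setT f ->
  (\int[mscale k m]_x f x = k%:num%:E * \int[m]_x f x)%E.
Proof.
move=> intf; have mf := measurable_int _ intf.
have mfp := measurable_funepos mf; have mfn := measurable_funeneg mf.
rewrite (integralE (mscale k m)) (integralE m) !ge0_integral_mscale//.
(* Distributing the scalar over positive part minus negative part excludes oo - oo; integrability
   makes the negative part finite. *)
rewrite [RHS]muleBr// fin_num_adde_defl// fin_numN.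
by apply: integrable_fin_num => //; exact: integrable_funeneg.
Qed.

Lemma measurable_affine (R : realType) (s c : R) :
  measurable_fun setT (fun x : R => s + c * x).
Proof. by apply: measurable_funD => //; exact: measurable_funM. Qed.

(** By uniqueness of Lebesgue measure, it suffices to compare the two sides on the intervals []a,
    b]]. *)
Lemma lebesgue_measure_affine (R : realType) (s c : R) (A : set R) :
  c != 0 -> measurable A ->
  lebesgue_measure A =
    (`|c|%:E * lebesgue_measure ((fun x : R => s + c * x)%R @^-1` A))%E.
Proof.
move=> c_neq0 mA.
have mphi : measurable_fun [set: measurableTypeR R]
  (fun x : R => s + c * x : measurableTypeR R) := measurable_affine s c.
pose phi : {mfun measurableTypeR R >-> measurableTypeR R} :=
  HB.pack (fun x : R => s + c * x) (isMeasurableFun.Build _ _ _ _ _ mphi).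
apply: (@lebesgue_measure_unique _
  (mscale (`|c|)%:nng (pushforward lebesgue_measure phi))) => // _ [[a b]] /= ab <-.
rewrite /mscale/= /pushforward.
have [c0|c0] : c < 0 \/ 0 < c by apply/orP; rewrite -neq_lt.
(* A negative [c] reverses the order: the preimage is closed on the left and open on the right. *)
- rewrite (_ : _ @^-1` _ = `[(b - s) / c, (a - s) / c[%classic); last first.
    by apply/seteqP; split=> x /=; rewrite !in_itv/= ler_ndivrMr ?ltr_ndivlMr//; lra.
  rewrite !lebesgue_measure_itv/= !lte_fin ltr_nM2r ?invr_lt0// ltrD2r.
  case: ifPn; rewrite ?mule0// -!EFinB -EFinM => _; congr EFin.
  by rewrite ltr0_norm//; field.
- rewrite (_ : _ @^-1` _ = `](a - s) / c, (b - s) / c]%classic); last first.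
    by apply/seteqP; split=> x /=; rewrite !in_itv/= ler_pdivlMr ?ltr_pdivrMr//; lra.
  rewrite !lebesgue_measure_itv/= !lte_fin ltr_pM2r ?invr_gt0// ltrD2r.
  case: ifPn; rewrite ?mule0// -!EFinB -EFinM => _; congr EFin.
  by rewrite gtr0_norm//; field.
Qed.

(** Lebesgue measure is |c| times its image under [x |-> s + c * x], so the integral transfers along
    this map; integrability is asked of the composite, from which that for the image measure
    follows. *)
Lemma Rintegral_affine (R : realType) (s c : R) (f : R -> R) : c != 0 ->
  measurable_fun setT f ->
  lebesgue_measure.-integrable setT (EFin \o (fun x => f (s + c * x))) ->
  \int[lebesgue_measure]_x f x =
  `|c| * \int[lebesgue_measure]_x f (s + c * x).
Proof.
move=> c_neq0 mf intf.
have mphi : measurable_fun [set: measurableTypeR R]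
  (fun x : R => s + c * x : measurableTypeR R) := measurable_affine s c.
pose phi : {mfun measurableTypeR R >-> measurableTypeR R} :=
  HB.pack (fun x : R => s + c * x) (isMeasurableFun.Build _ _ _ _ _ mphi).
have mEf : measurable_fun setT (EFin \o f) by exact/measurable_EFinP.
rewrite /Rintegral (eq_measure_integral
  (mscale (`|c|)%:nng (pushforward lebesgue_measure phi))).
  rewrite integral_mscale; last exact: integrable_pushforward.
  rewrite [X in (_ * X)%E]integral_pushforward//.
  rewrite fineM//.
  exact: (integrable_fin_num measurableT intf).
by move=> A mA _; exact: lebesgue_measure_affine.
Qed.

(** * The kernel 1 / (1 + x^2) as an integrable majorant *)

Lemma integralT_oneDsqrV (R : realType) :
  (\int[lebesgue_measure]_x (oneDsqr (x : R))^-1%:E)%E = pi%:E.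
Proof.
rewrite ge0_symfun_integralT//=.
- rewrite (_ : [set x | _] = `[0, +oo[%classic); last first.
    by apply/seteqP; split => x/=; rewrite in_itv/= andbT.
  by rewrite integral0y_oneDsqr -EFinM; congr EFin; field.
- exact: continuous_oneDsqrV.
- by move=> x/=; rewrite /oneDsqr sqrrN.
Qed.

Lemma measurable_oneDsqrV (R : realType) :
  measurable_fun [set: R] (fun x => (oneDsqr x)^-1).
Proof. by apply: continuous_measurable_fun; exact: continuous_oneDsqrV. Qed.

Lemma integrable_oneDsqrV (R : realType) :
  lebesgue_measure.-integrable setT (EFin \o (fun x : R => (oneDsqr x)^-1)).
Proof.
apply/integrableP; split.
  by apply/measurable_EFinP; exact: measurable_oneDsqrV.
under eq_integral do rewrite /= ger0_norm ?invr_ge0//.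
by rewrite integralT_oneDsqrV ltry.
Qed.

(** Common criterion for the integrands below: all of them are dominated by a multiple of this one
    kernel. *)
Lemma integrable_le_oneDsqrV (R : realType) (f : R -> R) (k : R) :
  measurable_fun setT f -> (forall x, `|f x| <= k * (oneDsqr x)^-1) ->
  lebesgue_measure.-integrable setT (EFin \o f).
Proof.
move=> mf fk.
apply: (@le_integrable _ (measurableTypeR R) R lebesgue_measure setT measurableT
  (EFin \o f)
  (fun x : R => k%:E * (oneDsqr x)^-1%:E)%E) => //.
- exact/measurable_EFinP.
- by move=> x _; rewrite /= lee_fin (le_trans (fk x))// ler_norm.
- by apply: integrableZl => //; exact: integrable_oneDsqrV.
Qed.

(** * Measurability and elementary trigonometric bounds *)

Lemma measurable_cosZ (R : realType) (t : R) :
  measurable_fun [set: R] (fun x => cos (t * x)).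
Proof.
apply: (measurableT_comp (f := cos)); last exact: measurable_funM.
by apply: continuous_measurable_fun; exact: continuous_cos.
Qed.

Lemma measurable_sinZ (R : realType) (t : R) :
  measurable_fun [set: R] (fun x => sin (t * x)).
Proof.
apply: (measurableT_comp (f := sin)); last exact: measurable_funM.
by apply: continuous_measurable_fun; exact: continuous_sin.
Qed.

Lemma measurable_funV (R : realType) (f : R -> R) :
  measurable_fun setT f -> measurable_fun setT (fun x => (f x)^-1).
Proof.
suff mV : measurable_fun setT (@GRing.inv R) by move=> mf; exact: measurableT_comp mV mf.
have m0 : measurable [set 0 : R] by exact: measurable_set1.
(* Inversion, with [0^-1 = 0], is discontinuous only at 0, so the line is cut into [[set 0]] and its
   open complement. *)
rewrite -(setUv [set 0]); apply/measurable_funU => //; first exact: measurableC.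
split; first exact: measurable_fun_set1.
apply: open_continuous_measurable_fun.
  by apply: closed_openC; exact: closed_eq.
by move=> x; rewrite inE/= => /eqP; exact: inv_continuous.
Qed.

(** Mean value theorem for [y > 0], the derivative [cos] being bounded by 1; then oddness. *)
Lemma norm_sin_le (R : realType) (x : R) : `|sin x| <= `|x|.
Proof.
have H (y : R) : 0 < y -> `|sin y| <= y.
  move=> y0; have [c _] := @MVT R sin cos 0 y y0 (fun x _ => is_derive_sin x)
    (continuous_subspaceT (@continuous_sin R)).
  rewrite sin0 !subr0 => ->.
  by rewrite normrM (gtr0_norm y0) ler_piMl ?cos_max// ltW.
have [x0|x0|->] := ltgtP x 0; last by rewrite sin0.
- by rewrite -[sin x]opprK -sinN normrN (ltr0_norm x0) H// oppr_gt0.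
- by rewrite (gtr0_norm x0) H.
Qed.

(** Half-angle formula: 1 - cos x = 2 sin^2 (x / 2). *)
Lemma onemcos_le (R : realType) (x : R) : 1 - cos x <= x ^+ 2 / 2.
Proof.
have -> : cos x = 1 - sin (x / 2) ^+ 2 *+ 2.
  by rewrite {1}[x](splitr x) cosD -!expr2 cos2sin2; ring.
have := norm_sin_le (x / 2).
rewrite -ler_sqr ?nnegrE// !real_normK ?num_real// => h.
by rewrite (_ : x ^+ 2 / 2 = (x / 2) ^+ 2 *+ 2); [lra|field].
Qed.

(** * Differentiation under the integral sign and the equation y'' = y *)

(** Domination is only asked at distance less than 1 from [a], so that [k] may depend on [a]. *)
Lemma is_derive_Rintegral (R : realType) (f df : R -> R -> R) (a k : R) :
  (forall t, lebesgue_measure.-integrable setT (EFin \o f t)) ->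
  (forall t x : R, is_derive t 1 (f ^~ x) (df t x)) ->
  (forall t x : R, a - 1 < t < a + 1 -> `|df t x| <= k * (oneDsqr x)^-1) ->
  is_derive a 1 (fun t => \int[lebesgue_measure]_x f t x)
    (\int[lebesgue_measure]_x df a x).
Proof.
move=> intf fdf dfk.
have d1f t x : partial1of2 f t x = df t x.
  by rewrite partial1of2E; apply: derive_val.
have k0 : 0 <= k.
  have := dfk a 0; rewrite /oneDsqr expr0n addr0 invr1 mulr1.
  move=> /(_ _)/(le_trans _)-> //; lra.
have Ia : `]a - 1, a + 1[%classic a by rewrite /= in_itv/=; lra.
have intk : lebesgue_measure.-integrable setT
    (EFin \o (fun x : R => k * (oneDsqr x)^-1)).
  apply: (integrable_le_oneDsqrV (k := k)).
    by apply: measurable_funM => //; exact: measurable_oneDsqrV.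
  by move=> x; rewrite ger0_norm// mulr_ge0// invr_ge0.
have kge0 (x : R) : 0 <= k * (oneDsqr x)^-1 by rewrite mulr_ge0// invr_ge0.
have dfD t x : `]a - 1, a + 1[%classic t -> setT x -> derivable (f ^~ x) t 1.
  by move=> _ _; apply: ex_derive.
have dfB t (x : R) : `]a - 1, a + 1[%classic t -> setT x ->
    `|partial1of2 f t x| <= k * (oneDsqr x)^-1.
  by rewrite /= in_itv/= d1f => tI _; exact: dfk.
have intf' t : `]a - 1, a + 1[%classic t ->
  lebesgue_measure.-integrable setT (EFin \o f t) by move=> _; exact: intf.
have -> : \int[lebesgue_measure]_x df a x =
    (fun t => \int[lebesgue_measure]_x f t x)^`()%classic a.
  rewrite (differentiation_under_integral measurableT Ia intf' dfD kge0 intk dfB).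
  by apply: eq_Rintegral => x _; rewrite d1f.
rewrite derive1E; apply: DeriveDef => //.
exact: (derivable_under_integral measurableT Ia intf' dfD kge0 intk dfB).
Qed.

(** Differentiability at 0 makes the mean value theorem available on [0, t], while the derivative is
    evaluated only at interior points; an equation known for [t > 0] thus determines the value at 0
    as well. *)
Lemma is_derive0_cst_ge0 (R : realType) (f df : R -> R) :
  (forall t : R, is_derive t 1 f (df t)) -> (forall t : R, 0 < t -> df t = 0) ->
  forall t : R, 0 <= t -> f t = f 0.
Proof.
move=> fdf df0 t; rewrite le_eqVlt => /predU1P[<-//|t0].
have [c|c +] := @MVT R f df 0 t t0 (fun x _ => fdf x).
  apply: continuous_subspaceT => x.
  by apply: differentiable_continuous; apply/derivable1_diffP; apply: ex_derive.
rewrite in_itv/= => /andP[c0 _]; rewrite df0// mul0r => /eqP.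
by rewrite subr_eq0 => /eqP.
Qed.

(** Factor y'' - y into first-order equations: e^(-t) (y + y') is a constant A, hence e^t y - (A /
    2) e^(2t) is constant too. Once A = 0, the second relation is the claim. *)
Lemma bounded_solution_expRN (R : realType) (y y1 y2 : R -> R) (M : R) :
  (forall t : R, is_derive t 1 y (y1 t)) ->
  (forall t : R, is_derive t 1 y1 (y2 t)) ->
  (forall t : R, 0 < t -> y2 t = y t) -> (forall t : R, 0 < t -> `|y t| <= M) ->
  forall t : R, 0 <= t -> y t = y 0 * expR (- t).
Proof.
move=> dy dy1 y2E yM.
have h1 (t : R) : 0 <= t -> expR (- t) * (y t + y1 t) = y 0 + y1 0.
  move=> t0.
  rewrite -[RHS]mul1r -expR0 -{1}oppr0.
  apply: (@is_derive0_cst_ge0 _ (fun t => expR (- t) * (y t + y1 t))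
    (fun t => expR (- t) * (y1 t + y2 t) - expR (- t) * (y t + y1 t))) => //.
  - move=> {t0}t; apply: is_derive_eq; rewrite /GRing.scale/=; ring.
  - by move=> {t0}t t0; rewrite y2E//; ring.
set A := y 0 + y1 0 in h1.
have h2 (t : R) : 0 <= t ->
    expR t * y t - A / 2 * expR (t + t) = y 0 - A / 2.
  move=> t0.
  transitivity (expR 0 * y 0 - A / 2 * expR (0 + 0)); last first.
    by rewrite addr0 expR0 mul1r mulr1.
  apply: (@is_derive0_cst_ge0 _ (fun t => expR t * y t - A / 2 * expR (t + t))
    (fun t => expR t * (y t + y1 t) - A * expR (t + t))) => //.
  - move=> {t0}t; apply: is_derive_eq; by rewrite /GRing.scale/=; field.
  - move=> {t0}t t0; rewrite -(h1 _ (ltW t0)) expRD.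
    have e : expR (- t) * expR t = 1 by rewrite -expRD addNr expR0.
    by ring: e.
have A0 : A = 0.
  (* Otherwise y grows like (A / 2) e^t, against the bound M. *)
  apply/eqP/negPn/negP => A0.
  have A_gt0 : 0 < `|A| by rewrite normr_gt0.
  (* The second relation gives A (e^t - e^(-t)) = 2 (y t - y 0 e^(-t)), whose right side is at most
     [K] in absolute value, while e^t - e^(-t) >= t. *)
  pose K := 2 * (M + `|y 0|).
  have K0 : 0 <= K.
    by rewrite mulr_ge0// addr_ge0// (le_trans _ (yM 1 ltr01)).
  have AK (t : R) : 0 < t -> `|A| * t <= K.
    move=> t0; have := h2 t (ltW t0); rewrite expRD.
    have e : expR (- t) * expR t = 1 by rewrite -expRD addNr expR0.
    have E1 := expR_ge1Dx t.
    have F1 : expR (- t) <= 1 by rewrite -expR0 ler_expR oppr_le0 ltW.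
    have F0 := expR_ge0 (- t).
    move=> /(congr1 ( *%R (expR (- t)))) h.
    have {}h : A * (expR t - expR (- t)) = 2 * (y t - y 0 * expR (- t)).
      have -> : y t = expR (- t) * expR t * y t by rewrite e mul1r.
      have : A * expR t = A * expR t * (expR (- t) * expR t) by rewrite e mulr1.
      by move: h; lra.
    have {}h : `|A| * (expR t - expR (- t)) = 2 * `|y t - y 0 * expR (- t)|.
      rewrite -[X in X * `|_|](@ger0_norm _ 2)// -normrM -h normrM.
      by rewrite [X in _ = _ * X]ger0_norm//; lra.
    apply: (@le_trans _ _ (`|A| * (expR t - expR (- t)))).
      by apply: ler_wpM2l => //; lra.
    rewrite h ler_wpM2l// (le_trans (ler_normB _ _))// lerD ?yM//.
    by rewrite normrM (ger0_norm F0) ler_piMr.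
  (* At this point [AK] reads K + 1 <= K. *)
  have := AK ((K + 1) / `|A|); rewrite [`|A| * _]mulrC divfK ?gt_eqF//.
  by rewrite divr_gt0 ?ltr_wpDl// => /(_ isT); lra.
move=> t t0; have := h2 t t0; rewrite A0 !mul0r !subr0 => <-.
by rewrite mulrAC -expRD subrr expR0 mul1r.
Qed.

(** * The Fourier integrals of 1 / (1 + x^2) *)

Lemma norm_cos_oneDsqrV (R : realType) (t x : R) :
  `|cos (t * x) / oneDsqr x| <= 1 * (oneDsqr x)^-1.
Proof.
by rewrite normrM [X in _ * X]ger0_norm ?invr_ge0// ler_wpM2r ?invr_ge0// cos_max.
Qed.

Lemma norm_sin_oneDsqrV (R : realType) (t x : R) :
  `|sin (t * x) / oneDsqr x| <= 1 * (oneDsqr x)^-1.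
Proof.
by rewrite normrM [X in _ * X]ger0_norm ?invr_ge0// ler_wpM2r ?invr_ge0// sin_max.
Qed.

Lemma integrable_cos_oneDsqrV (R : realType) (t : R) :
  lebesgue_measure.-integrable setT
    (EFin \o (fun x : R => cos (t * x) / oneDsqr x)).
Proof.
apply: integrable_le_oneDsqrV (norm_cos_oneDsqrV t).
by apply: measurable_funM; [exact: measurable_cosZ|exact: measurable_oneDsqrV].
Qed.

Lemma integrable_sin_oneDsqrV (R : realType) (t : R) :
  lebesgue_measure.-integrable setT
    (EFin \o (fun x : R => sin (t * x) / oneDsqr x)).
Proof.
apply: integrable_le_oneDsqrV (norm_sin_oneDsqrV t).
by apply: measurable_funM; [exact: measurable_sinZ|exact: measurable_oneDsqrV].
Qed.

(** Serves with [b] equal to [x] or [x ^+ 2]: the hypothesis on [a] cancels the singularity at 0,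
    and for [b = 0] the quotient is 0 by the convention on inverses. *)
Lemma norm_divM_oneDsqr (R : realType) (a b k x : R) :
  0 <= k -> `|a| <= k * `|b| -> `|a / (b * oneDsqr x)| <= k * (oneDsqr x)^-1.
Proof.
move=> k0 ab; rewrite normrM normfV normrM [`|oneDsqr x|]ger0_norm//.
rewrite invfM mulrA ler_wpM2r ?invr_ge0//.
have [->|b0] := eqVneq b 0; first by rewrite normr0 invr0 mulr0.
by rewrite ler_pdivrMr ?normr_gt0.
Qed.

Lemma norm_onemcos_le (R : realType) (t x : R) :
  `|1 - cos (t * x)| <= t ^+ 2 / 2 * `|x ^+ 2|.
Proof.
rewrite !ger0_norm ?sqr_ge0 ?subr_ge0 ?cos_le1//.
by apply: (le_trans (onemcos_le _)); rewrite exprMn mulrAC.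
Qed.

Lemma is_derive_onemcos (R : realType) (t x : R) :
  is_derive t 1 (fun t => (1 - cos (t * x)) / (x ^+ 2 * oneDsqr x))
    (sin (t * x) / (x * oneDsqr x)).
Proof.
apply: is_derive_eq; rewrite /GRing.scale/=.
have [->|x0] := eqVneq x 0; first by rewrite !(mulr0, mul0r, addr0, sin0, oppr0).
have o0 : oneDsqr x != 0 by rewrite gt_eqF// (lt_le_trans ltr01).
by field; rewrite x0 o0.
Qed.

(* The factor x / x makes the formula hold at x = 0 too, where both sides vanish
   because 0^-1 = 0. *)
Lemma is_derive_sin_div (R : realType) (t x : R) :
  is_derive t 1 (fun t => sin (t * x) / (x * oneDsqr x))
    (x / x * (cos (t * x) / oneDsqr x)).
Proof.
apply: is_derive_eq; rewrite /GRing.scale/=.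
have [->|x0] := eqVneq x 0; first by rewrite !(mulr0, mul0r, addr0, sin0, oppr0).
have o0 : oneDsqr x != 0 by rewrite gt_eqF// (lt_le_trans ltr01).
by field; rewrite x0 o0.
Qed.

Lemma integrable_onemcos_oneDsqrV (R : realType) (t : R) :
  lebesgue_measure.-integrable setT
    (EFin \o (fun x : R => (1 - cos (t * x)) / (x ^+ 2 * oneDsqr x))).
Proof.
apply: (integrable_le_oneDsqrV (k := t ^+ 2 / 2)).
  apply: measurable_funM.
    by apply: measurable_funB => //; exact: measurable_cosZ.
  apply: measurable_funV; apply: measurable_funM.
    exact: measurable_funX.
  by apply: continuous_measurable_fun; exact: continuous_oneDsqr.
move=> x; apply: norm_divM_oneDsqr; first by rewrite mulr_ge0// sqr_ge0.
exact: norm_onemcos_le.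
Qed.

Lemma integrable_sin_div (R : realType) (t : R) :
  lebesgue_measure.-integrable setT
    (EFin \o (fun x : R => sin (t * x) / (x * oneDsqr x))).
Proof.
apply: (integrable_le_oneDsqrV (k := `|t|)).
  apply: measurable_funM; first exact: measurable_sinZ.
  apply: measurable_funV; apply: measurable_funM => //.
  by apply: continuous_measurable_fun; exact: continuous_oneDsqr.
move=> x; apply: norm_divM_oneDsqr => //.
by rewrite -normrM norm_sin_le.
Qed.

Lemma integrable_onemcos_sqr (R : realType) (t : R) :
  lebesgue_measure.-integrable setT
    (EFin \o (fun x : R => (1 - cos (t * x)) / x ^+ 2)).
Proof.
(* After multiplication by 1 + x^2 the integrand becomes (1 - cos(t x)) / x^2 + (1 - cos(t x)), with
   summands at most t^2 / 2 and 2. *)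
apply: (integrable_le_oneDsqrV (k := t ^+ 2 / 2 + 2)).
  apply: measurable_funM.
    by apply: measurable_funB => //; exact: measurable_cosZ.
  by apply: measurable_funV; exact: measurable_funX.
move=> x; have k0 : 0 <= t ^+ 2 / 2 by rewrite mulr_ge0// sqr_ge0.
have [->|x0] := eqVneq x 0.
  by rewrite expr0n/= invr0 mulr0 normr0 mulr_ge0 ?invr_ge0// addr_ge0.
have x2 : 0 < x ^+ 2 by rewrite exprn_even_gt0.
rewrite ler_pdivlMr ?(lt_le_trans ltr01)// normrM normfV (gtr0_norm x2).
have := norm_onemcos_le t x; rewrite (gtr0_norm x2) => h.
have c2 : `|1 - cos (t * x)| <= 2.
  by rewrite ger0_norm ?subr_ge0 ?cos_le1//; have := cos_geN1 (t * x); lra.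
rewrite /oneDsqr mulrDr mulr1 divfK ?gt_eqF// lerD// ler_pdivrMr//.
Qed.

(** Replacing [x] by [t * x] brings a factor [t] from the Jacobian and [t ^- 2] from the square.
    Being linear in [t], the integral will vanish on taking second derivatives. *)
Lemma Rintegral_onemcos_sqrZ (R : realType) (t : R) : 0 < t ->
  \int[lebesgue_measure]_x ((1 - cos (t * (x : R))) / x ^+ 2) =
  (\int[lebesgue_measure]_x ((1 - cos (x : R)) / x ^+ 2)) * t.
Proof.
move=> t0.
have E : (fun x : R => (1 - cos (0 + t * x)) / (0 + t * x) ^+ 2) =
         (fun x : R => t ^- 2 * ((1 - cos (t * x)) / x ^+ 2)).
  by apply/funext => x; rewrite !add0r exprMn invfM mulrCA.
have intt := integrable_onemcos_sqr t.
have mf : measurable_fun setT (fun x : R => (1 - cos x) / x ^+ 2).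
  apply: measurable_funM.
    apply: measurable_funB => //; apply: continuous_measurable_fun.
    exact: continuous_cos.
  by apply: measurable_funV; exact: measurable_funX.
have intE : lebesgue_measure.-integrable setT
    (EFin \o (fun x : R => (1 - cos (0 + t * x)) / (0 + t * x) ^+ 2)).
  by rewrite E; exact: (integrableZl measurableT (t ^- 2) intt).
rewrite (Rintegral_affine (lt0r_neq0 t0) mf intE) E gtr0_norm// RintegralZl//.
by field; rewrite gt_eqF.
Qed.
Lemma Rintegral_oneDsqrV (R : realType) :
  \int[lebesgue_measure]_x (oneDsqr (x : R))^-1 = pi.
Proof. by rewrite /Rintegral integralT_oneDsqrV. Qed.

Lemma Rintegral_cos_oneDsqrV_ge0 (R : realType) (t : R) : 0 <= t ->
  \int[lebesgue_measure]_x (cos (t * x) / oneDsqr x) = pi * expR (- t).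
Proof.
pose H1 := \int[lebesgue_measure]_x ((1 - cos (x : R)) / x ^+ 2).
pose G (u : R) :=
  \int[lebesgue_measure]_x ((1 - cos (u * x)) / (x ^+ 2 * oneDsqr x)).
pose G1 (u : R) := \int[lebesgue_measure]_x (sin (u * x) / (x * oneDsqr x)).
pose F (u : R) := \int[lebesgue_measure]_x (cos (u * x) / oneDsqr x).
have dG (u : R) : is_derive u 1 G (G1 u).
  apply: (@is_derive_Rintegral _
    (fun v x => (1 - cos (v * x)) / (x ^+ 2 * oneDsqr x))
    (fun v x => sin (v * x) / (x * oneDsqr x)) u (`|u| + 1)).
  - exact: integrable_onemcos_oneDsqrV.
  - exact: is_derive_onemcos.
  (* Here |v - u| < 1, hence |sin(v x)| <= |v| |x| <= (|u| + 1) |x|. *)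
  - move=> v x uv; apply: norm_divM_oneDsqr; first by rewrite addr_ge0.
    rewrite (le_trans (norm_sin_le _))// normrM ler_wpM2r//.
    by rewrite ler_norml; have := ler_norm u; have := ler_norm (- u);
      rewrite normrN; lra.
have dG1 (u : R) : is_derive u 1 G1 (F u).
  (* The factor [x / x] is 1 off the null set [[set 0]]. *)
  have -> : F u = \int[lebesgue_measure]_x (x / x * (cos (u * x) / oneDsqr x)).
    congr fine; apply: ae_eq_integral => //.
    - exact: measurable_int (integrable_cos_oneDsqrV u).
    - apply/measurable_EFinP; apply: measurable_funM.
        by apply: measurable_funM => //; exact: measurable_funV.
      by apply: measurable_funM; [exact: measurable_cosZ|exact: measurable_oneDsqrV].
    - exists [set 0]; split => //; first exact: lebesgue_measure_set1.
      move=> x /=; apply: contra_notP => /eqP x0 _.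
      by rewrite divff// mul1r.
  apply: (@is_derive_Rintegral _ (fun v x => sin (v * x) / (x * oneDsqr x))
    (fun v x => x / x * (cos (v * x) / oneDsqr x)) u 1).
  - exact: integrable_sin_div.
  - exact: is_derive_sin_div.
  - move=> v x _; apply: le_trans (norm_cos_oneDsqrV v x).
    rewrite normrM ler_piMl//; have [->|x0] := eqVneq x 0.
      by rewrite mul0r normr0.
    by rewrite divff// normr1.
have FE (u : R) : 0 < u -> F u = G u - H1 * u + pi.
  move=> u0; rewrite -Rintegral_onemcos_sqrZ// -Rintegral_oneDsqrV.
  rewrite -RintegralB//; [|exact: integrable_onemcos_oneDsqrV|exact: integrable_onemcos_sqr].
  rewrite -RintegralD//; [| |exact: integrable_oneDsqrV].
    apply: eq_Rintegral => x _.
    (* At 0 both quotients by [x ^+ 2] are 0 by convention, and [cos 0 = 1] makes the rest agree. *)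
    have [->|x0] := eqVneq x 0.
      by rewrite mulr0 cos0 subrr !mul0r subrr add0r mul1r.
    have o0 : oneDsqr x != 0 by rewrite gt_eqF// (lt_le_trans ltr01).
    by rewrite /oneDsqr in o0 *; field; rewrite x0 o0.
  exact: (integrableB measurableT (integrable_onemcos_oneDsqrV u)
    (integrable_onemcos_sqr u)).
have FM (u : R) : `|F u| <= pi.
  apply: (le_trans (le_normr_Rintegral measurableT (integrable_cos_oneDsqrV u))).
  rewrite -Rintegral_oneDsqrV; apply: le_Rintegral => //.
  - exact: integrable_norm (integrable_cos_oneDsqrV u).
  - exact: integrable_oneDsqrV.
  - by move=> x _; rewrite (le_trans (norm_cos_oneDsqrV u x))// mul1r.
have G0 : G 0 = 0.
  by rewrite /G; under eq_Rintegral do rewrite mul0r cos0 subrr mul0r; rewrite Rintegral_cst// mul0r.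
(* The equation is solved for [G u - H1 * u + pi] in place of [F]: it is twice differentiable on the
   whole line with second derivative [F u], and coincides with [F u] for [u > 0]. *)
have key : forall u : R, 0 <= u ->
    G u - H1 * u + pi = (G 0 - H1 * 0 + pi) * expR (- u).
  apply: (@bounded_solution_expRN _ (fun u => G u - H1 * u + pi) (fun u => G1 u - H1) F pi).
  - by move=> u; apply: is_derive_eq; rewrite /GRing.scale/=; ring.
  - by move=> u; apply: is_derive_eq; rewrite subr0.
  - exact: FE.
  - by move=> u u0; rewrite -FE.
rewrite le_eqVlt => /predU1P[<-|t0].
  under eq_Rintegral do rewrite mul0r cos0 mul1r.
  by rewrite Rintegral_oneDsqrV oppr0 expR0 mulr1.
by rewrite -/(F t) FE// key ?ltW// G0 mulr0 subrr add0r.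
Qed.

Lemma Rintegral_cos_oneDsqrV (R : realType) (t : R) :
  \int[lebesgue_measure]_x (cos (t * x) / oneDsqr x) = pi * expR (- `|t|).
Proof.
rewrite -Rintegral_cos_oneDsqrV_ge0//; apply: eq_Rintegral => x _.
by case: ger0P => // _; rewrite mulNr cosN.
Qed.

(** Oddness: the substitution of -x for x shows that the integral is its own opposite. *)
Lemma Rintegral_sin_oneDsqrV (R : realType) (t : R) :
  \int[lebesgue_measure]_x (sin (t * x) / oneDsqr x) = 0.
Proof.
have E : (fun x : R => sin (t * (0 + -1 * x)) / oneDsqr (0 + -1 * x)) =
         (fun x : R => - 1 * (sin (t * x) / oneDsqr x)).
  by apply/funext => x; rewrite add0r mulN1r mulrN sinN /oneDsqr sqrrN; ring.
have intt := integrable_sin_oneDsqrV t.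
have mf : measurable_fun setT (fun x : R => sin (t * x) / oneDsqr x).
  by apply: measurable_funM; [exact: measurable_sinZ|exact: measurable_oneDsqrV].
have intE : lebesgue_measure.-integrable setT
    (EFin \o (fun x : R => sin (t * (0 + -1 * x)) / oneDsqr (0 + -1 * x))).
  by rewrite E; exact: (integrableZl measurableT (- 1) intt).
have := @Rintegral_affine R 0 (- 1) _ _ mf intE.
by rewrite oppr_eq0 oner_eq0 E RintegralZl// normrN1 => /(_ isT); lra.
Qed.

(** * Probability laws with a given density *)

Lemma probability_of_density (R : realType) (f : R -> R) :
  measurable_fun setT f -> (forall x, 0 <= f x) ->
  (\int[lebesgue_measure]_x (f x)%:E = 1)%E ->
  exists P : probability (measurableTypeR R) R,
    forall A : set R, measurable A ->
      P A = (\int[@lebesgue_measure R]_(x in A) (f x)%:E)%E.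
Proof.
move=> mf f0 f1.
pose nu (A : set (measurableTypeR R)) :=
  (\int[@lebesgue_measure R]_(x in A) (f x)%:E)%E.
have nu0 : nu set0 = 0%E by rewrite /nu integral_set0.
have nu_ge0 A : (0 <= nu A)%E by apply: integral_ge0 => x _; rewrite lee_fin.
have nu_sigma : semi_sigma_additive nu.
  move=> A mA tA mUA; rewrite /nu ge0_integral_bigcup//=; last 2 first.
  - by apply/measurable_EFinP; exact: measurable_funTS.
  - by move=> x _; rewrite lee_fin.
  by apply: is_cvg_ereal_nneg_natsum_cond => n _ _; exact: nu_ge0.
pose mnu := isMeasure.Build _ _ _ nu nu0 nu_ge0 nu_sigma.
pose m : {measure set (measurableTypeR R) -> \bar R} := HB.pack nu mnu.
pose P : probability (measurableTypeR R) R :=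
  HB.pack nu mnu (@Measure_isProbability.Build _ _ R m f1).
by exists P.
Qed.

(** The Radon-Nikodym derivative of [P] has the same integral as [f] over every measurable set, so
    the two agree almost everywhere and [f] may replace it in the change of variables. *)
Lemma Rintegral_density (R : realType) (P : probability (measurableTypeR R) R)
    (f h : R -> R) :
  measurable_fun setT f ->
  (forall A : set R, measurable A ->
     P A = (\int[@lebesgue_measure R]_(x in A) (f x)%:E)%E) ->
  P.-integrable setT (EFin \o h) ->
  \int[P]_x h x = \int[lebesgue_measure]_x (h x * f x).
Proof.
move=> mf PE inth.
have Pmu : P `<< (@lebesgue_measure R).
  apply/null_content_dominatesP => A mA muA0; rewrite PE//.
  apply: null_set_integral => //.
  by apply/measurable_EFinP; exact: measurable_funTS.
have mEf : measurable_fun [set: measurableTypeR R] (EFin \o f) by exact/measurable_EFinP.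
have mh := measurable_int _ inth.
set g := Radon_Nikodym (charge_of_finite_measure P) (@lebesgue_measure R).
have intg : lebesgue_measure.-integrable setT g.
  exact: Radon_Nikodym_integrable.
have gf : ae_eq lebesgue_measure setT g (EFin \o f).
  apply: integral_ae_eq => // E _ mE.
  by rewrite -Radon_Nikodym_integral//= PE.
rewrite /Rintegral -(Radon_Nikodym_change_of_variables Pmu measurableT inth).
congr fine; transitivity (\int[lebesgue_measure]_x ((EFin \o h) \* (EFin \o f)) x)%E.
  apply: ae_eq_integral => //.
  - exact: (emeasurable_funM mh (measurable_int _ intg)).
  - exact: (emeasurable_funM mh mEf).
  - exact: (ae_eqe_mul2l _ gf).
by apply: eq_integral => x _; rewrite /= EFinM.
Qed.

(** * The sine power series *)

(** Induction on [N], by the recurrence sin((N + 2) psi) = 2 cos psi sin((N + 1) psi) - sin(N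
    psi). *)
Lemma sum_sin_expr (R : realType) (psi x : R) (N : nat) :
  (x ^+ 2 - 2 * x * cos psi + 1) *
    (\sum_(0 <= n < N) sin ((n + 1)%:R * psi) * x ^+ n) =
  sin psi - x ^+ N * sin ((N + 1)%:R * psi) + x ^+ N.+1 * sin (N%:R * psi).
Proof.
elim: N => [|N IH].
  by rewrite big_geq// mulr0 expr0 add0n mul0r sin0 mulr0 addr0 mul1r mul1r subrr.
rewrite big_nat_recr//= mulrDr IH.
have sinS2 : sin ((N.+1 + 1)%:R * psi) =
    2 * cos psi * sin ((N + 1)%:R * psi) - sin (N%:R * psi).
  have -> : (N.+1 + 1)%:R * psi = (N + 1)%:R * psi + psi.
    by rewrite addn1 -natr1 addn1 mulrDl mul1r.
  have -> : N%:R * psi = (N + 1)%:R * psi - psi.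
    by rewrite addn1 -natr1 mulrDl mul1r addrK.
  by rewrite sinD sinB; ring.
by rewrite sinS2 !exprS addn1; ring.
Qed.

Lemma cvg_sum_sin_expr (R : realType) (psi x : R) : -1 < x < 1 ->
  x ^+ 2 - 2 * x * cos psi + 1 != 0 ->
  (fun N : nat => \sum_(0 <= n < N) sin ((n + 1)%:R * psi) * x ^+ n)
    @ \oo --> sin psi / (x ^+ 2 - 2 * x * cos psi + 1).
Proof.
move=> x1 D0; have nx1 : `|x| < 1 by rewrite ltr_norml.
set D := x ^+ 2 - 2 * x * cos psi + 1 in D0 *.
(* Both boundary terms of the telescoped sum have this shape; they are squeezed by |x|^n. *)
have xs0 (u : nat -> R) : (x ^+ n * sin (u n)) @[n --> \oo] --> (0 : R).
  apply/norm_cvg0P; apply: (@squeeze_cvgr _ _ _ _ (cst 0) (fun n => `|x| ^+ n)).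
  - by apply: nearW => n; rewrite /= normr_ge0 normrM normrX ler_piMr ?exprn_ge0 ?sin_max.
  - exact: cvg_cst.
  - by apply: cvg_expr; rewrite normr_id.
have -> : (fun N : nat => \sum_(0 <= n < N) sin ((n + 1)%:R * psi) * x ^+ n) =
    (fun N : nat => (sin psi - x ^+ N * sin ((N + 1)%:R * psi) +
      x * (x ^+ N * sin (N%:R * psi))) / D).
  apply/funext => N; apply: (mulfI D0).
  by rewrite sum_sin_expr exprS; field.
apply: cvgMl.
rewrite -[X in _ --> X]addr0 -[X in _ --> X + _]subr0 -{2}(mulr0 x).
apply: cvgD; first by apply: cvgB; [exact: cvg_cst|exact: xs0].
by apply: cvgMr; exact: xs0.
Qed.

(** * The stable density and its characteristic function *)

Lemma stable1_denomE (R : realType) (phi x : R) :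
  x ^+ 2 - 2 * x * sin phi + 1 = (x - sin phi) ^+ 2 + cos phi ^+ 2.
Proof. by rewrite cos2sin2; ring. Qed.

Lemma cos_theta_gt0 (R : realType) (theta : R) : -1 < theta < 1 ->
  0 < cos (pi * theta / 2).
Proof.
move=> /andP[h1 h2]; apply: cos_gt0_pihalf; have := pi_gt0 R => p0.
have a1 : 0 < pi * (1 + theta) by rewrite mulr_gt0//; lra.
have a2 : 0 < pi * (1 - theta) by rewrite mulr_gt0//; lra.
by apply/andP; split; lra.
Qed.

Lemma stable1_denom_gt0 (R : realType) (theta x : R) : -1 < theta < 1 ->
  0 < x ^+ 2 - 2 * x * sin (pi * theta / 2) + 1.
Proof.
move=> th; rewrite stable1_denomE ltr_wpDl ?sqr_ge0//.
by rewrite exprn_gt0// cos_theta_gt0.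
Qed.

Lemma stable1_pdf_ge0 (R : realType) (theta x : R) : -1 < theta < 1 ->
  0 <= stable1_pdf theta x.
Proof.
move=> th; rewrite /stable1_pdf divr_ge0 ?mulr_ge0 ?pi_ge0//.
  exact/ltW/cos_theta_gt0.
exact/ltW/stable1_denom_gt0.
Qed.

Lemma measurable_stable1_pdf (R : realType) (theta : R) :
  measurable_fun setT (stable1_pdf theta).
Proof.
apply: measurable_funM => //; apply: measurable_funV.
apply: measurable_funM => //; apply: measurable_funD => //.
apply: measurable_funB => //.
by apply: measurable_funM => //; exact: measurable_funM.
Qed.

Lemma stable1_pdf_affine (R : realType) (theta y : R) : -1 < theta < 1 ->
  stable1_pdf theta (sin (pi * theta / 2) + cos (pi * theta / 2) * y) =
  (pi * cos (pi * theta / 2))^-1 / oneDsqr y.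
Proof.
move=> th; have c0 := cos_theta_gt0 th.
rewrite /stable1_pdf stable1_denomE addrAC subrr add0r.
have pn : (pi : R) != 0 by rewrite gt_eqF ?pi_gt0.
have on : oneDsqr y != 0 by rewrite gt_eqF// (lt_le_trans ltr01).
rewrite exprMn -{2}[cos _ ^+ 2]mulr1 -mulrDr [y ^+ 2 + 1]addrC -/(oneDsqr y).
move: (cos _) c0 => c /lt0r_neq0 c0; move: (pi : R) pn => p pn.
by field; rewrite on c0.
Qed.

(** Substitute x = s + c y: the Jacobian c cancels the c in the denominator of the rescaled density.
    Taking [h] constant gives the total mass, cosine and sine give the characteristic function. *)
Lemma Rintegral_stable1_pdf (R : realType) (theta : R) (h : R -> R) :
  -1 < theta < 1 -> measurable_fun setT h -> (forall x, `|h x| <= 1) ->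
  \int[lebesgue_measure]_x (h x * stable1_pdf theta x) =
  pi^-1 * \int[lebesgue_measure]_y
    (h (sin (pi * theta / 2) + cos (pi * theta / 2) * y) / oneDsqr y).
Proof.
move=> th mh h1; set s := sin _; set c := cos _.
have c0 : 0 < c := cos_theta_gt0 th.
have E : (fun y : R => h (s + c * y) * stable1_pdf theta (s + c * y)) =
  (fun y : R => (pi * c)^-1 * (h (s + c * y) / oneDsqr y)).
  by apply/funext => y; rewrite stable1_pdf_affine// mulrCA.
have inth : lebesgue_measure.-integrable setT
    (EFin \o (fun y : R => h (s + c * y) / oneDsqr y)).
  apply: (integrable_le_oneDsqrV (k := 1)).
    apply: measurable_funM; last exact: measurable_oneDsqrV.
    exact: (measurableT_comp mh (measurable_affine s c)).
  move=> y; rewrite normrM [X in _ * X]ger0_norm ?invr_ge0//.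
  by rewrite ler_wpM2r// invr_ge0.
have intE : lebesgue_measure.-integrable setT
    (EFin \o (fun y : R => h (s + c * y) * stable1_pdf theta (s + c * y))).
  by rewrite E; exact: (integrableZl measurableT (pi * c)^-1 inth).
have mf : measurable_fun setT (fun x => h x * stable1_pdf theta x).
  by apply: measurable_funM => //; exact: measurable_stable1_pdf.
rewrite (Rintegral_affine (lt0r_neq0 c0) mf intE) E gtr0_norm// RintegralZl//.
by rewrite mulrA invfM mulrCA divff ?mulr1// gt_eqF.
Qed.

Lemma integralT_stable1_pdf (R : realType) (theta : R) : -1 < theta < 1 ->
  (\int[lebesgue_measure]_x (stable1_pdf theta x)%:E = 1)%E.
Proof.
move=> th; have : \int[lebesgue_measure]_x stable1_pdf theta x = 1.
  have := @Rintegral_stable1_pdf R theta (cst 1) th (measurable_cst _).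
  rewrite /cst normr1 => /(_ (fun=> lexx _)).
  under eq_Rintegral do rewrite mul1r.
  under [in X in _ = X -> _]eq_Rintegral do rewrite mul1r.
  by rewrite Rintegral_oneDsqrV mulVf ?gt_eqF ?pi_gt0.
(* fine sends both infinities to 0, so a real integral equal to 1 is genuine. *)
rewrite /Rintegral; case: (integral _ _ _) => [r /= ->//| |] /= /eqP.
- by rewrite eq_sym oner_eq0.
- by rewrite eq_sym oner_eq0.
Qed.

(** The sign of [t] disappears because cosine is even, sine is odd and |t| sign t = t. *)
Lemma stable1_charfunE (R : realType) (theta t : R) :
  let a := pi * theta / 2 in
  stable1_charfun theta t =
  Complex (expR (- (cos a * `|t|)) * cos (t * sin a))
          (expR (- (cos a * `|t|)) * sin (t * sin a)).
Proof.
move=> a; rewrite /stable1_charfun /cexp/=.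
rewrite !(mul0r, mulr0, mul1r, subr0, add0r, addr0, oppr0) expR0 /=.
rewrite !mul1r cosN sinN mulrN opprK.
have aE : pi / 2 * theta = a by rewrite /a mulrAC.
have -> : `|t| * cos (pi / 2 * theta * Num.sg t) = cos a * `|t|.
  rewrite aE mulrC; have [t0|t0|->] := ltgtP t 0.
  - by rewrite ltr0_sg// mulrN1 cosN.
  - by rewrite gtr0_sg// mulr1.
  - by rewrite normr0 !mulr0.
have -> : `|t| * sin (pi / 2 * theta * Num.sg t) = t * sin a.
  rewrite aE; have [t0|t0|->] := ltgtP t 0.
  - by rewrite ltr0_sg// ltr0_norm// mulrN1 sinN mulrNN.
  - by rewrite gtr0_sg// gtr0_norm// mulr1.
  - by rewrite normr0 !mul0r.
by simpc.
Qed.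

(** After the affine substitution, t x = t s + t c y; the addition formulas split the integrand, the
    sine integral in y vanishes and the cosine one is pi e^(-c |t|). *)
Lemma charfun_stable1_density (R : realType) (theta t : R)
    (P : probability (measurableTypeR R) R) :
  -1 < theta < 1 ->
  (forall A : set R, measurable A ->
     P A = (\int[@lebesgue_measure R]_(x in A) (stable1_pdf theta x)%:E)%E) ->
  charfun P t = stable1_charfun theta t.
Proof.
move=> th PE; rewrite stable1_charfunE.
set a := pi * theta / 2; set s := sin a; set c := cos a.
have c0 : 0 < c := cos_theta_gt0 th.
have mpdf := measurable_stable1_pdf theta.
have intP (h : R -> R) : measurable_fun setT h -> (forall x, `|h x| <= 1) ->
    P.-integrable setT (EFin \o h).
  move=> mh h1; apply: (@le_integrable _ _ _ P setT measurableT _ (cst 1%E)).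
  - exact/measurable_EFinP.
  - by move=> x _; rewrite /= normr1 lee_fin.
  - exact: finite_measure_integrable_cst.
have ics := integrable_cos_oneDsqrV (t * c).
have isn := integrable_sin_oneDsqrV (t * c).
have Ecs : \int[lebesgue_measure]_y (cos (t * c * y) / oneDsqr y) =
    pi * expR (- (c * `|t|)).
  by rewrite Rintegral_cos_oneDsqrV normrM (gtr0_norm c0) [`|t| * c]mulrC.
have Esn := Rintegral_sin_oneDsqrV (t * c).
have pn : (pi : R) != 0 by rewrite gt_eqF ?pi_gt0.
rewrite /charfun; congr Complex.
- have mh := measurable_cosZ t; have h1 x : `|cos (t * x)| <= 1 by exact: cos_max.
  rewrite (Rintegral_density mpdf PE (intP _ mh h1)) Rintegral_stable1_pdf//.
  rewrite -/a -/s -/c.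
  transitivity (pi^-1 * \int[lebesgue_measure]_y
     (cos (t * s) * (cos (t * c * y) / oneDsqr y) -
      sin (t * s) * (sin (t * c * y) / oneDsqr y))).
    congr (_ * _); apply: eq_Rintegral => y _.
    by rewrite mulrDr mulrA cosD mulrBl !mulrA.
  rewrite RintegralB//; last 2 first.
  + exact: (integrableZl measurableT (cos (t * s)) ics).
  + exact: (integrableZl measurableT (sin (t * s)) isn).
  by rewrite !RintegralZl// Ecs Esn mulr0 subr0 mulrCA mulKf// mulrC.
- have mh := measurable_sinZ t; have h1 x : `|sin (t * x)| <= 1 by exact: sin_max.
  rewrite (Rintegral_density mpdf PE (intP _ mh h1)) Rintegral_stable1_pdf//.
  rewrite -/a -/s -/c.
  transitivity (pi^-1 * \int[lebesgue_measure]_y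
     (sin (t * s) * (cos (t * c * y) / oneDsqr y) +
      cos (t * s) * (sin (t * c * y) / oneDsqr y))).
    congr (_ * _); apply: eq_Rintegral => y _.
    by rewrite mulrDr mulrA sinD mulrDl !mulrA.
  rewrite RintegralD//; last 2 first.
  + exact: (integrableZl measurableT (sin (t * s)) ics).
  + exact: (integrableZl measurableT (cos (t * s)) isn).
  by rewrite !RintegralZl// Ecs Esn mulr0 addr0 mulrCA mulKf// mulrC.
Qed.

Theorem mainTheorem3 (R : realType) (theta : R)
    (theta_itv : -1 < theta < 1) :
  (exists P : probability (measurableTypeR R) R,
      (forall t : R, charfun P t = stable1_charfun theta t) /\
      is_density P (stable1_pdf theta)) /\
  (forall x : R, -1 < x < 1 ->
     (fun N : nat =>
        1 / pi * \sum_(0 <= n < N)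
                    sin (pi / 2 * (n + 1)%:R * (1 - theta)) * x ^+ n)
       @ \oo --> stable1_pdf theta x).
Proof.
split.
  have [P PE] := probability_of_density (measurable_stable1_pdf theta)
    (fun x => stable1_pdf_ge0 x theta_itv) (integralT_stable1_pdf theta_itv).
  exists P; split; first by move=> t; exact: charfun_stable1_density.
  split => //; first exact: measurable_stable1_pdf.
  by move=> x; exact: stable1_pdf_ge0.
(* [psi] is the complement of [pi * theta / 2], which exchanges sine and cosine and turns the
   general series into the stated one. *)
move=> x x1; pose psi := pi / 2 * (1 - theta).
have psiE : psi = pi / 2 - pi * theta / 2 by rewrite /psi mulrBr mulr1 mulrAC.
have sin_psi : sin psi = cos (pi * theta / 2).
  by rewrite psiE sinB sin_pihalf cos_pihalf mul1r mul0r subr0.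
have cos_psi : cos psi = sin (pi * theta / 2).
  by rewrite psiE cosB sin_pihalf cos_pihalf mul1r mul0r add0r.
have D0 := stable1_denom_gt0 x theta_itv.
have := @cvg_sum_sin_expr R psi x x1; rewrite cos_psi sin_psi gt_eqF// => /(_ isT) h.
rewrite (_ : stable1_pdf theta x = 1 / pi *
  (cos (pi * theta / 2) / (x ^+ 2 - 2 * x * sin (pi * theta / 2) + 1))); last first.
  by rewrite /stable1_pdf invfM mul1r mulrCA.
have E n : pi / 2 * (n + 1)%:R * (1 - theta) = (n + 1)%:R * psi.
  by rewrite /psi; ring.
under eq_fun do under eq_bigr do rewrite E.
by apply: cvgMr.
Qed.
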